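(* Consider the broken sample detection problem with joint distribution $\mathsf P_{X,Y}$ possibly depending on $n$ and $m=m_n\le n$. Assume that $I_{\chi^2}(X;Y)<\infty$ for every $n$. Suppose that for some positive integer $r$ (possibly depending on $n$), $$\mathbb E_{\mathsf P_{X,Y}}\big[L_r^2(X,Y)\big]=o\Big(m\,\big(I^{(r)}_{\chi^2}(X;Y)\big)^2\Big)\quad\text{as }n\to\infty.$$ Then the statistic $$T_{\mathrm{inner}}=\frac1{\sqrt{nm}}\sum_{i=1}^n\sum_{j=1}^mL_r(X_i,Y_j)$$ achieves strong detection (by rejecting $\mathcal H_0$ when $T_{\mathrm{inner}}$ exceeds an appropriately chosen threshold, depending on $n$), provided that $$\lim_{n\to\infty}\frac mn I^{(r)}_{\chi^2}(X;Y)=\infty.$$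
   Context: Broken sample detection problem. $\mathsf P_{X,Y}$ is a known joint distribution on a product space $\mathcal X\times\mathcal Y$ with marginals $\mathsf P_X,\mathsf P_Y$ (all may depend on $n$). One observes $\mathbf X=(X_1,\dots,X_n)\in\mathcal X^n$ and $\mathbf Y=(Y_1,\dots,Y_m)\in\mathcal Y^m$, $m\le n$. Under $\mathcal H_0$: $(\mathbf X,\mathbf Y)\sim \mathsf P_X^{\otimes n}\otimes\mathsf P_Y^{\otimes m}$. Under $\mathcal H_1$: $\pi$ is drawn uniformly from the set $S_{m,n}$ of injections $[m]\to[n]$, and conditionally on $\pi$ the pairs $(X_{\pi(i)},Y_i)$, $i\in[m]$, are i.i.d. from $\mathsf P_{X,Y}$ and, independently, the $X_j$, $j\in[n]\setminus\pi([m])$, are i.i.d. from $\mathsf P_X$. Only $(\mathbf X,\mathbf Y)$ is observed. A sequence of tests achieves strong detection if its Type-I and Type-II error probabilities both tend to $0$ as $n\to\infty$. $I_{\chi^2}(X;Y)=\chi^2(\mathsf P_{X,Y}\|\mathsf P_X\otimes\mathsf P_Y)$, where $\chi^2(P\|Q)=\int(\frac{dP}{dQ}-1)^2dQ$ if $P\ll Q$ and $\infty$ otherwise. When it is finite, the likelihood ratio $L=\frac{d\mathsf P_{X,Y}}{d(\mathsf P_X\otimes\mathsf P_Y)}$ lies in $L_2(\mathsf P_X\otimes\mathsf P_Y)$ and the Hilbert-Schmidt operator $(\mathcal L h)(x)=\mathbb E_{Y\sim\mathsf P_Y}[L(x,Y)h(Y)]$ from $L_2(\mathsf P_Y)$ to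 $L_2(\mathsf P_X)$ yields the spectral decomposition $L(x,y)=\sum_{k\ge0}\lambda_k\phi_k(x)\psi_k(y)$, with $\{\phi_k\}$, $\{\psi_k\}$ orthonormal in $L_2(\mathsf P_X)$, $L_2(\mathsf P_Y)$, singular values $1=\lambda_0\ge\lambda_1\ge\lambda_2\ge\cdots\ge 0$, and $\phi_0=\psi_0\equiv1$ (terms with $\lambda_k=0$, or beyond the last singular value, are zero). Define the truncations (the $k=0$ term is omitted) $$L_r(x,y)=\sum_{k=1}^r\lambda_k\phi_k(x)\psi_k(y),\qquad I^{(r)}_{\chi^2}(X;Y)=\mathbb E_{\mathsf P_X\otimes\mathsf P_Y}[L_r^2(X,Y)]=\sum_{k=1}^r\lambda_k^2.$$ *)

(* Defs.v *)
From HB Require Import structures.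
From mathcomp Require Import all_boot all_order all_algebra.
From mathcomp Require Import all_classical all_reals all_analysis.

Set Implicit Arguments.
Unset Strict Implicit.
Unset Printing Implicit Defensive.

Import Order.TTheory GRing.Theory Num.Theory.
Import numFieldNormedType.Exports.

Local Open Scope classical_set_scope.
Local Open Scope charge_scope.
Local Open Scope ring_scope.

Section iid_law.
Context d (T : measurableType d) (R : realType).

Definition tcons n (z : T * n.-tuple T) : n.+1.-tuple T :=
  [the n.+1.-tuple T of z.1 :: z.2].

Lemma measurable_tcons n : measurable_fun [set: T * n.-tuple T] (@tcons n).
Proof.
apply: (@measurable_cons _ _ _ _ fst n snd).
- exact: measurable_fst.
- exact: measurable_snd.
Qed.

HB.instance Definition _ n :=
  isMeasurableFun.Build _ _ _ _ (@tcons n) (@measurable_tcons n).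

Fixpoint iid_law (P : probability T R) n : probability (n.-tuple T) R :=
  if n isn't n'.+1 then \d_ [tuple]
  else distribution (P \x iid_law P n')%E (@tcons n').

End iid_law.

Section marginals.
Context dX dY (X : measurableType dX) (Y : measurableType dY) (R : realType).

HB.instance Definition _ :=
  isMeasurableFun.Build _ _ _ _ (@fst X Y) measurable_fst.
HB.instance Definition _ :=
  isMeasurableFun.Build _ _ _ _ (@snd X Y) measurable_snd.

Definition margX (P : probability (X * Y)%type R) : probability X R :=
  distribution P (@fst X Y).

Definition margY (P : probability (X * Y)%type R) : probability Y R :=
  distribution P (@snd X Y).

Definition indep_law (P : probability (X * Y)%type R)
  : probability (X * Y)%type R := (margX P \x margY P)%E.

End marginals.

(* The observation ((X_1, ..., X_n), (Y_1, ..., Y_m)) takes its values in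
   n.-tuple X * m.-tuple Y. *)
Section broken_sample.
Context dX dY (X : measurableType dX) (Y : measurableType dY) (R : realType).
Variables (n m : nat).

Definition null_law (P : probability (X * Y)%type R)
  : probability (n.-tuple X * m.-tuple Y)%type R :=
  (iid_law (margX P) n \x iid_law (margY P) m)%E.

(* From m pairs z and n spare X-samples x: Y_i is the second component of the
   i-th pair, whose first component is put at position p i; every position
   outside the image of p receives its spare sample (the other spare samples
   are discarded). *)
Definition plant (p : {ffun 'I_m -> 'I_n})
    (zx : m.-tuple (X * Y)%type * n.-tuple X) : n.-tuple X * m.-tuple Y :=
  ([tuple if [pick i | p i == j] is Some i then (tnth zx.1 i).1
          else tnth zx.2 j | j < n],
   [tuple (tnth zx.1 i).2 | i < m]).

Lemma measurable_plant p : measurable_fun setT (plant p).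
Proof.
apply/measurable_fun_pairP; split; apply/measurable_fun_tnthP => i.
- rewrite (_ : _ \o _ = fun zx : m.-tuple (X * Y)%type * n.-tuple X =>
    if [pick k | p k == i] is Some k then (tnth zx.1 k).1
    else tnth zx.2 i); last by apply/funext => zx /=; rewrite tnth_mktuple.
  case: pickP => [k _|_].
    apply: (@measurableT_comp _ _ _ _ _ _ fst) => //.
    exact: (measurableT_comp (measurable_tnth k) measurable_fst).
  exact: (measurableT_comp (measurable_tnth i) measurable_snd).
- rewrite (_ : _ \o _ = fun zx : m.-tuple (X * Y)%type * n.-tuple X =>
    (tnth zx.1 i).2); last by apply/funext => zx /=; rewrite tnth_mktuple.
  apply: (@measurableT_comp _ _ _ _ _ _ snd) => //.
  exact: (measurableT_comp (measurable_tnth i) measurable_fst).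
Qed.

HB.instance Definition _ p :=
  isMeasurableFun.Build _ _ _ _ (plant p) (measurable_plant p).

(* conditional law of the observation given pi = p, for p injective *)
Definition planted_law (P : probability (X * Y)%type R)
    (p : {ffun 'I_m -> 'I_n})
  : probability (n.-tuple X * m.-tuple Y)%type R :=
  distribution (iid_law P m \x iid_law (margX P) n)%E (plant p).

Definition injections : {set {ffun 'I_m -> 'I_n}} :=
  [set p : {ffun 'I_m -> 'I_n} | injectiveb p]%SET.

Lemma card_injections_gt0 : (m <= n)%N -> (0 < #|injections|)%N.
Proof.
move=> mn; apply/card_gt0P; exists [ffun i => widen_ord mn i].
rewrite inE; apply/injectiveP => i j; rewrite !ffunE => /(congr1 val) /= ij.
exact: val_inj.
Qed.

(* [m <= n] makes the set of injections nonempty. *)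
Definition alt_law (mn : (m <= n)%N) (P : probability (X * Y)%type R)
    (A : set (n.-tuple X * m.-tuple Y)) : \bar R :=
  ((#|injections|%:R^-1)%:E * \sum_(p in injections) planted_law P p A)%E.

Section alt_law_probability.
Variables (mn : (m <= n)%N) (P : probability (X * Y)%type R).

Let alt_law0 : alt_law mn P set0 = 0%E.
Proof. by rewrite /alt_law big1 ?mule0// => p _; rewrite measure0. Qed.

Let alt_law_ge0 A : (0 <= alt_law mn P A)%E.
Proof.
by rewrite /alt_law mule_ge0// ?lee_fin// sume_ge0.
Qed.

Let alt_law_sigma_additive : semi_sigma_additive (alt_law mn P).
Proof.
move=> F mF tF mUF; rewrite /alt_law.
rewrite [X in X @ _ --> _](_ : _ = fun k => ((#|injections|%:R^-1)%:E *
    \sum_(p in injections) \sum_(0 <= i < k) planted_law P p (F i))%E).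
  apply: cvgeZl => //; apply: cvg_nnesum => p _.
    by apply: nearW => k; exact: sume_ge0.
  exact: measure_semi_sigma_additive.
by apply/funext => k; rewrite exchange_big/= ge0_sume_distrr// => i _;
  exact: sume_ge0.
Qed.

HB.instance Definition _ := isMeasure.Build _ _ _ (alt_law mn P)
  alt_law0 alt_law_ge0 alt_law_sigma_additive.

Let alt_law_setT : alt_law mn P setT = 1%E.
Proof.
rewrite /alt_law; under eq_bigr do rewrite probability_setT.
rewrite sumEFin sumr_const -EFinM mulVf// pnatr_eq0 -lt0n.
exact: card_injections_gt0.
Qed.

HB.instance Definition _ := Measure_isProbability.Build _ _ _ (alt_law mn P)
  alt_law_setT.

End alt_law_probability.
End broken_sample.

Definition chi2 d (T : measurableType d) (R : realType)
    (P Q : probability T R) : \bar R :=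
  if `[< P `<< Q >] then
    (\int[Q]_x (('d (charge_of_finite_measure P) '/d Q) x - 1) ^+ 2)%E
  else +oo%E.

Section spectral.
Context dX dY (X : measurableType dX) (Y : measurableType dY) (R : realType).
Variable P : probability (X * Y)%type R.

Definition I_chi2 : \bar R := chi2 P (indep_law P).

Definition lratio (z : X * Y) : R :=
  fine (('d (charge_of_finite_measure P) '/d (indep_law P)) z).

Definition hs_operator (h : Y -> R) (x : X) : R :=
  fine ('E_(margY P)[fun y => (lratio (x, y) * h y)%R])%E.

(* The value of phi k and psi k is irrelevant when lam k = 0: this covers the
   spaces in which no infinite orthonormal family exists. *)
Record spectral_decomposition (lam : nat -> R) (phi : nat -> X -> R)
    (psi : nat -> Y -> R) : Prop := SpectralDecomposition {
  sv0 : lam 0%N = 1 ;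
  sv_noninc : forall j k, (j <= k)%N -> lam k <= lam j ;
  sv_ge0 : forall k, 0 <= lam k ;
  phi0 : phi 0%N = cst 1 ;
  psi0 : psi 0%N = cst 1 ;
  phi_L2 : forall k, lam k != 0 -> phi k \in Lfun (margX P) 2%:E ;
  psi_L2 : forall k, lam k != 0 -> psi k \in Lfun (margY P) 2%:E ;
  phi_orthonormal : forall j k, lam j != 0 -> lam k != 0 ->
    ('E_(margX P)[fun x => (phi j x * phi k x)%R] = (j == k)%:R%:E)%E ;
  psi_orthonormal : forall j k, lam j != 0 -> lam k != 0 ->
    ('E_(margY P)[fun y => (psi j y * psi k y)%R] = (j == k)%:R%:E)%E ;
  hs_psi : forall k, lam k != 0 ->
    {ae margX P, forall x, hs_operator (psi k) x = lam k * phi k x} ;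
  lratio_expansion :
    ('E_(indep_law P)[fun z => ((lratio z -
        \sum_(0 <= k < K) lam k * phi k z.1 * psi k z.2) ^+ 2)%R]
      @[K --> \oo] --> 0)%E
}.

Definition trunc_lratio (lam : nat -> R) (phi : nat -> X -> R)
    (psi : nat -> Y -> R) (r : nat) (z : X * Y) : R :=
  \sum_(1 <= k < r.+1) lam k * phi k z.1 * psi k z.2.

(* For a spectral decomposition this expectation is the finite number
   \sum_(1 <= k < r.+1) lam k ^+ 2. *)
Definition trunc_I_chi2 (lam : nat -> R) (phi : nat -> X -> R)
    (psi : nat -> Y -> R) (r : nat) : R :=
  fine ('E_(indep_law P)[fun z => (trunc_lratio lam phi psi r z ^+ 2)%R])%E.

End spectral.

Definition T_inner dX dY (X : measurableType dX) (Y : measurableType dY)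
    (R : realType) (n m : nat) (f : X * Y -> R)
    (s : n.-tuple X * m.-tuple Y) : R :=
  (Num.sqrt (n * m)%:R)^-1 *
    \sum_(i < n) \sum_(j < m) f (tnth s.1 i, tnth s.2 j).

(* rej n is the rejection region of the n-th test *)
Definition strong_detection (d : nat -> measure_display)
    (Om : forall n, measurableType (d n)) (R : realType)
    (P0 P1 : forall n, probability (Om n) R) (rej : forall n, set (Om n)) : Prop :=
  [/\ forall n, measurable (rej n),
      (P0 n (rej n) @[n --> \oo] --> 0)%E &
      (P1 n (~` rej n) @[n --> \oo] --> 0)%E].

(* Main.v *)
Require Import Defs.
From HB Require Import structures.
From mathcomp Require Import all_boot all_order all_algebra.
From mathcomp Require Import all_classical all_reals all_analysis.
From mathcomp Require Import measurable_realfun.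
From mathcomp Require Import ring lra.

(** Let S be the sum of L_r(X_i, Y_j) over all i and j, and let I be the sum of
the lambda_k^2 for 1 <= k <= r. The test compares S with m I / 2, half of its
mean under the alternative, and Chebyshev's inequality bounds both errors. What
makes the variances computable is that the phi_k and the psi_k are orthonormal
and, being orthogonal to phi_0 = psi_0 = 1, centred.

Under the null hypothesis the n m summands of S are centred and pairwise
uncorrelated with variance I. Hence E S^2 = n m I ([has_mean_null_sqr]) and S
exceeds m I / 2 with probability at most 4 n / (m I), which tends to 0 because
(m / n) I tends to infinity ([null_rejection_le]).

Under the alternative, condition on the injection p; the bounds below do not
depend on p, so they survive averaging. The singular value decomposition gives
E_P[phi_k(X) psi_l(Y)] = lambda_k if k = l, and 0 otherwise
([has_mean_phi_psi]). Therefore E_P[L_r] = I, the m matched pairs contribute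
m I to the mean of S, and the fluctuation of their contribution has variance at
most m E_P[L_r^2] ([has_mean_matched_sqr]), which is negligible against
(m I)^2 by assumption. The unmatched summands are centred. Two of them, at
(i, j) and (i', j'), are correlated only if they coincide or if they are
swapped, that is i = p j' and i' = p j; their covariance is then the sum of the
lambda_k^2, respectively of the lambda_k^4, hence at most I since
lambda_k <= 1 ([has_mean_planted_mixed]). A given summand has at most one
swapped partner, so the second moment of the unmatched part is at most
2 n m I ([has_mean_unmatched_sqr], [unmatched_overlap_le]), which is negligible
against (m I)^2 for the same reason as under the null hypothesis
([planted_acceptance_le]).

Every moment of the samples is reduced to moments at a single coordinate by the
product formulas [has_mean_iid] and [has_mean_planted]. *)

Set Implicit Arguments.
Unset Strict Implicit.
Unset Printing Implicit Defensive.

Import Order.TTheory GRing.Theory Num.Theory.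
Import numFieldNormedType.Exports.

Local Open Scope classical_set_scope.
Local Open Scope ring_scope.

(** * Means of real random variables *)

(** Integrability and value are kept together: all moments are assembled from
sums and products, and both have to be carried through each assembly step. *)
Definition has_mean d (T : measurableType d) (R : realType)
    (P : probability T R) (f : T -> R) (c : R) :=
  P.-integrable setT (EFin \o f) /\ (\int[P]_x (f x)%:E = c%:E)%E.

Section mean.
Context d (T : measurableType d) (R : realType) (P : probability T R).
Implicit Types f g : T -> R.

Lemma has_mean_measurable f c : has_mean P f c -> measurable_fun setT f.
Proof. by case=> /measurable_int /measurable_EFinP. Qed.

Lemma eq_has_mean f g a b : f =1 g -> a = b -> has_mean P f a -> has_mean P g b.
Proof. by move=> /funext -> ->. Qed.

Lemma has_mean_expectation f c : has_mean P f c -> ('E_P[f] = c%:E)%E.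
Proof. by case=> _; rewrite unlock. Qed.

Lemma has_mean_cst c : has_mean P (fun=> c) c.
Proof.
split; last by have := expectation_cst P c; rewrite unlock.
exact: finite_measure_integrable_cst.
Qed.

Lemma has_meanD f g a b : has_mean P f a -> has_mean P g b ->
  has_mean P (fun x => f x + g x) (a + b).
Proof.
move=> [fi fa] [gi gb]; split.
  exact: (@integrableD _ _ _ P setT measurableT (EFin \o f) (EFin \o g)).
by rewrite EFinD -fa -gb -integralD_EFin.
Qed.

Lemma has_meanZ k f a : has_mean P f a -> has_mean P (fun x => k * f x) (k * a).
Proof.
move=> [fi fa]; split; first exact: (@integrableZl _ _ _ P setT measurableT k (EFin \o f)).
by under eq_integral do rewrite EFinM; rewrite integralZl// fa.
Qed.

Lemma has_mean_sum (I : eqType) (s : seq I) (h : I -> T -> R) (c : I -> R) :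
  (forall i, i \in s -> has_mean P (h i) (c i)) ->
  has_mean P (fun x => \sum_(i <- s) h i x) (\sum_(i <- s) c i).
Proof.
elim: s => [_|i s ih hs].
  apply: (eq_has_mean _ _ (has_mean_cst 0)) => [x|]; by rewrite big_nil.
apply: (eq_has_mean _ _ (has_meanD (hs i (mem_head _ _)) (ih _))) => [x||j js].
- by rewrite big_cons.
- by rewrite big_cons.
- by apply: hs; rewrite inE js orbT.
Qed.

Lemma has_mean_mul_L2 f g c : f \in Lfun P 2%:E -> g \in Lfun P 2%:E ->
  ('E_P[fun x => (f x * g x)%R] = c%:E)%E -> has_mean P (fun x => f x * g x) c.
Proof.
move=> fL gL fgc; split; first exact/Lfun1_integrable/Lfun2_mul_Lfun1.
by move: fgc; rewrite unlock.
Qed.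

Lemma markov_mean f (c a : R) : (forall x, 0 <= f x) -> has_mean P f c -> 0 < a ->
  (P [set x | (a <= f x)%R] <= (c / a)%:E)%E.
Proof.
move=> f0 [fi fc] a0.
have mf : measurable_fun setT (EFin \o f) := measurable_int _ fi.
have mA : measurable [set x | a <= f x].
  have := emeasurable_fun_c_infty measurableT mf a%:E.
  by rewrite setTI; under eq_set do rewrite /= lee_fin.
rewrite EFinM muleC lee_pdivlMl// -fc.
rewrite -integral_cst//.
apply: (@le_trans _ _ (\int[P]_(x in [set x | (a <= f x)%R]) (f x)%:E)%E).
  apply: ge0_le_integral => //.
  - by move=> x xA; rewrite lee_fin ltW.
  - exact: measurable_funTS.
by apply: ge0_subset_integral => // x _; rewrite /= lee_fin.
Qed.

End mean.

Section mean_transfer.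
Context d d' (T : measurableType d) (T' : measurableType d') (R : realType).
Variables (P : probability T R) (X : {RV P >-> T'}).

Lemma has_mean_distribution (f : T' -> R) c : measurable_fun setT f ->
  has_mean P (f \o X) c -> has_mean (distribution P X) f c.
Proof.
move=> mf [fi fc].
have mX : measurable_fun setT X by [].
split.
  apply: (@integrable_pushforward _ _ _ _ _ X mX P setT (EFin \o f)) => //.
  exact/measurable_EFinP.
by rewrite integral_distribution//; exact/measurable_EFinP.
Qed.

Lemma has_mean_comp (f : T' -> R) c :
  has_mean (distribution P X) f c -> has_mean P (f \o X) c.
Proof.
move=> [fi fc].
have mf : measurable_fun setT (EFin \o f) := measurable_int _ fi.
have fXi : P.-integrable setT (EFin \o (f \o X)).
  apply/integrableP; split; first exact: (measurableT_comp mf).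
  move/integrableP: fi => [_]; rewrite ge0_integral_distribution//.
  exact: measurableT_comp.
by split=> //; rewrite -fc [RHS]integral_distribution.
Qed.

End mean_transfer.

(** * Product formulas for independent coordinates *)

Section mean_product.
Context d1 d2 (T1 : measurableType d1) (T2 : measurableType d2) (R : realType).
Variables (P : probability T1 R) (Q : probability T2 R).

Lemma has_mean_prod f g a b : has_mean P f a -> has_mean Q g b ->
  has_mean (P \x Q)%E (fun z => f z.1 * g z.2) (a * b).
Proof.
move=> hf hg.
have mf := has_mean_measurable hf; have mg := has_mean_measurable hg.
move: hf hg => [fi fa] [gi gb].
have mfg : measurable_fun setT (EFin \o (fun z : T1 * T2 => f z.1 * g z.2)).
  by apply/measurable_EFinP/measurable_funM; exact: measurableT_comp.
have mabs d (T : measurableType d) (h : T -> R) : measurable_fun setT h ->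
    measurable_fun setT (fun x => `|h x|%:E).
  by move=> mh; apply/measurable_EFinP; exact: measurableT_comp.
have fgi : (P \x Q)%E.-integrable setT (EFin \o (fun z : T1 * T2 => f z.1 * g z.2)).
  apply/(integrable12ltyP _ _ mfg) => /=.
  have -> : (\int[P]_x \int[Q]_y `|f x * g y|%:E =
      (\int[P]_x `|f x|%:E) * \int[Q]_y `|g y|%:E)%E.
    rewrite -ge0_integralZr//; [|exact: mabs|exact: integral_ge0].
    apply: eq_integral => x _.
    rewrite -ge0_integralZl//; last exact: mabs.
    by apply: eq_integral => y _; rewrite normrM EFinM.
  move/integrableP: fi => [_ fi]; move/integrableP: gi => [_ gi].
  apply: lte_mul_pinfty => //; first exact: integral_ge0.
  by rewrite ge0_fin_numE//; exact: integral_ge0.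
split => //.
rewrite -[LHS](integral12_prod_meas1 fgi) /fubini_F /=.
transitivity (\int[P]_x ((f x)%:E * b%:E))%E.
  apply: eq_integral => x _; rewrite -gb -integralZl//.
by rewrite integralZr// fa.
Qed.

Lemma has_mean_fst f a : has_mean P f a -> has_mean (P \x Q)%E (fun z => f z.1) a.
Proof.
move=> fa; apply: eq_has_mean (has_mean_prod fa (has_mean_cst Q 1)) => [z|].
  by rewrite mulr1.
by rewrite mulr1.
Qed.

End mean_product.

Lemma has_mean_iid d (T : measurableType d) (R : realType)
    (P : probability T R) n (g : 'I_n -> T -> R) (c : 'I_n -> R) :
  (forall i, has_mean P (g i) (c i)) ->
  has_mean (iid_law P n) (fun t => \prod_(i < n) g i (tnth t i)) (\prod_(i < n) c i).
Proof.
elim: n g c => [|n ih] g c gc.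
  apply: (eq_has_mean _ _ (has_mean_cst _ 1)) => [t|]; by rewrite big_ord0.
apply: has_mean_distribution.
  apply: measurable_prod => i _.
  apply: measurableT_comp (measurable_tnth i).
  exact: has_mean_measurable (gc i).
apply: (eq_has_mean _ _ (has_mean_prod (gc ord0) (ih _ _ (fun i => gc (lift ord0 i))))).
  move=> [x t] /=; rewrite big_ord_recl; congr (_ * _).
  by apply: eq_bigr => i _; rewrite tnthS.
by rewrite big_ord_recl.
Qed.

Lemma prod_atE (R : comPzRingType) (I : finType) (i0 : I) (a : I -> R) :
  \prod_i (if i == i0 then a i else 1) = a i0.
Proof. by rewrite -big_mkcond big_pred1_eq. Qed.

Section iid_pairs.
Context d (T : measurableType d) (R : realType) (P : probability T R).

(** Distinct coordinates are independent, and [u], [v] are centred, so only the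
diagonal survives. *)
Lemma has_mean_iid_pair n (u v : T -> R) c (i j : 'I_n) :
  has_mean P u 0 -> has_mean P v 0 -> has_mean P (fun x => u x * v x) c ->
  has_mean (iid_law P n) (fun t => u (tnth t i) * v (tnth t j)) ((i == j)%:R * c).
Proof.
move=> u0 v0 uvc.
pose e k : R := if k == i then (if k == j then c else 0)
                else if k == j then 0 else 1.
pose g k x := (if k == i then u x else 1) * (if k == j then v x else 1).
have gP k : has_mean P (g k) (e k).
  rewrite /e; have [ki|ki] := boolP (k == i); have [kj|kj] := boolP (k == j).
  - by apply: eq_has_mean uvc => // x; rewrite /g ki kj.
  - by apply: eq_has_mean u0 => // x; rewrite /g ki (negbTE kj) mulr1.
  - by apply: eq_has_mean v0 => // x; rewrite /g (negbTE ki) kj mul1r.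
  - apply: eq_has_mean (has_mean_cst P 1) => // x.
    by rewrite /g (negbTE ki) (negbTE kj) mulr1.
apply: eq_has_mean (has_mean_iid gP) => [t|].
  by rewrite big_split /= !prod_atE.
have [ij|ij] := eqVneq i j.
  rewrite mul1r -[RHS](prod_atE i (fun=> c)); apply: eq_bigr => k _.
  by rewrite /e -ij; case: eqP.
by rewrite mul0r; apply/eqP/prodf_eq0; exists i; rewrite // /e eqxx (negbTE ij).
Qed.

Lemma has_mean_iid_sumM n (u v : T -> R) c :
  has_mean P u 0 -> has_mean P v 0 -> has_mean P (fun x => u x * v x) c ->
  has_mean (iid_law P n)
    (fun t => (\sum_(i < n) u (tnth t i)) * (\sum_(i < n) v (tnth t i))) (n%:R * c).
Proof.
move=> u0 v0 uvc.
apply: (@eq_has_mean _ _ _ _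
  (fun t => \sum_(i < n) \sum_(j < n) u (tnth t i) * v (tnth t j)) _
  (\sum_(i < n) \sum_(j < n) (i == j)%:R * c)) => [t||].
- by rewrite mulr_suml; apply: eq_bigr => i _; rewrite mulr_sumr.
- under eq_bigr => i _.
    rewrite (bigD1 i)//= big1 ?eqxx ?addr0 ?mul1r; last first.
      by move=> j /negbTE ji; rewrite eq_sym ji mul0r.
    over.
  by rewrite sumr_const card_ord mulr_natl.
- apply: has_mean_sum => i _; apply: has_mean_sum => j _.
  exact: has_mean_iid_pair.
Qed.

End iid_pairs.

(** * Product formula for the planted law *)

Section planted_moments.
Context dX dY (X : measurableType dX) (Y : measurableType dY) (R : realType).
Context (P : probability (X * Y)%type R) (n m : nat).
Context (p : {ffun 'I_m -> 'I_n}).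
Hypothesis p_inj : injective p.

Lemma tnth_plant (zx : m.-tuple (X * Y) * n.-tuple X) j :
  tnth (plant p zx).1 (p j) = (tnth zx.1 j).1.
Proof.
rewrite tnth_mktuple; case: pickP => [k /eqP/p_inj ->//|/(_ j)]; by rewrite eqxx.
Qed.

(** The observation consists of the independent blocks (X_(p j), Y_j), one for
each [j], and of the independent X_i with [i] outside the image of [p]. Since [p]
is injective, both kinds of blocks can be indexed by positions of X-samples, which
turns the mean into one product over all positions. *)
Lemma has_mean_planted (g : 'I_n -> X -> R) (h : 'I_m -> Y -> R) (c : 'I_n -> R) :
  (forall i, measurable_fun setT (g i)) -> (forall j, measurable_fun setT (h j)) ->
  (forall j, has_mean P (fun z => g (p j) z.1 * h j z.2) (c (p j))) ->
  (forall i, i \notin codom p -> has_mean (margX P) (g i) (c i)) ->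
  has_mean (planted_law P p)
    (fun s => (\prod_(i < n) g i (tnth s.1 i)) * (\prod_(j < m) h j (tnth s.2 j)))
    (\prod_(i < n) c i).
Proof.
move=> mg mh gh gc.
have splitp (F : 'I_n -> R) :
    \prod_i F i = (\prod_j F (p j)) * \prod_i (if i \in codom p then 1 else F i).
  rewrite (bigID [pred i | i \in codom p])/=; congr (_ * _).
    rewrite (eq_bigl (mem (p @: [set: 'I_m])%SET)); last first.
      by move=> i; apply/codomP/imsetP => [[j ->]|[j _ ->]]; exists j; rewrite ?inE.
    rewrite big_imset/=; last by move=> j k _ _; exact: p_inj.
    by apply: eq_bigl => j; rewrite inE.
  by rewrite big_mkcond; apply: eq_bigr => i _; rewrite if_neg.
apply: has_mean_distribution.
  apply: measurable_funM; apply: measurable_prod => i _.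
    apply: measurableT_comp => //.
    exact: (measurableT_comp (measurable_tnth i) measurable_fst).
  apply: measurableT_comp => //.
  exact: (measurableT_comp (measurable_tnth i) measurable_snd).
have hP := has_mean_iid gh.
have hX : has_mean (iid_law (margX P) n)
    (fun t => \prod_i (if i \in codom p then 1 else g i (tnth t i)))
    (\prod_i (if i \in codom p then 1 else c i)).
  apply: (@has_mean_iid _ _ _ _ _ (fun i x => if i \in codom p then 1 else g i x)).
  move=> i; case: ifPn => [_|/gc//]; exact: has_mean_cst.
apply: eq_has_mean (has_mean_prod hP hX) => [[z x]|]; last by rewrite -splitp.
rewrite /= [X in _ = X * _]splitp big_split/= -!mulrA; congr (_ * _).
  by apply: eq_bigr => j _; rewrite -(tnth_plant (z, x)).
rewrite mulrC; congr (_ * _); apply: eq_bigr => i _; last by rewrite tnth_mktuple.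
case: ifPn => // ip; rewrite tnth_mktuple; case: pickP => // j /eqP pj.
by move: ip; rewrite -pj codom_f.
Qed.


Lemma has_mean_planted_pairs (F : m.-tuple (X * Y) -> R) (G : n.-tuple X * m.-tuple Y -> R) c :
  measurable_fun setT G ->
  (forall zx, G (plant p zx) = F zx.1) ->
  has_mean (iid_law P m) F c -> has_mean (planted_law P p) G c.
Proof.
move=> mG GF Fc; apply: has_mean_distribution => //.
by apply: eq_has_mean (has_mean_fst _ Fc) => // zx /=; rewrite GF.
Qed.

End planted_moments.

(** * Moments of the singular functions *)

Section change_of_law.
Context d (T : measurableType d) (R : realType) (P Q : probability T R).
Hypothesis PQ : P `<< Q.

Let RN := Radon_Nikodym (charge_of_finite_measure P) Q.

(** The density may be negative on a null set; it agrees almost everywhere with a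
nonnegative density, whose product with |f| integrates to the mean of |f|. *)
Lemma integrable_Radon_Nikodym (f : T -> \bar R) : P.-integrable setT f ->
  Q.-integrable setT (fun x => f x * RN x)%E.
Proof.
move=> fi; have mf := measurable_int _ fi.
have mRN : measurable_fun setT RN by apply: measurable_int; exact: Radon_Nikodym_integrable.
apply/integrableP; split; first exact: emeasurable_funM.
have ai : P.-integrable setT (abse \o f) by exact: integrable_abse.
have /integrableP[_] := Radon_Nikodym_SigmaFinite.integrableM PQ (fun x => abse_ge0 (f x))
  measurableT ai.
rewrite (_ : integral _ _ _ = \int[Q]_x `|f x * RN x|)%E//.
have mSF : measurable_fun setT (Radon_Nikodym_SigmaFinite.f P Q).
  by apply: measurable_int; exact: Radon_Nikodym_SigmaFinite.f_integrable PQ.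
apply: ae_eq_integral => //.
- apply: measurableT_comp => //; apply: emeasurable_funM => //.
  exact: measurableT_comp.
- by apply: measurableT_comp => //; exact: emeasurable_funM.
have := ae_eq_Radon_Nikodym_SigmaFinite PQ measurableT.
apply: filterS => x /(_ I) /= e _.
by rewrite !abseM abse_id e.
Qed.

Lemma has_mean_change_of_law (f : T -> R) (c : R) : P.-integrable setT (EFin \o f) ->
  has_mean Q (fun x => f x * fine (RN x)) c -> has_mean P f c.
Proof.
move=> fi [_ fc]; split => //.
rewrite -fc -(Radon_Nikodym_change_of_variables PQ measurableT fi).
by apply: eq_integral => x _; rewrite EFinM fineK// Radon_Nikodym_fin_num.
Qed.

End change_of_law.

Section spectral_moments.
Context dX dY (X : measurableType dX) (Y : measurableType dY) (R : realType).
Variable P : probability (X * Y)%type R.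
Variables (lam : nat -> R) (phi : nat -> X -> R) (psi : nat -> Y -> R).
Hypothesis hI : (I_chi2 P < +oo)%E.
Hypothesis hdec : spectral_decomposition P lam phi psi.

(** The chi-square divergence is infinite by convention in the absence of
absolute continuity. *)
Lemma I_chi2_dominated : P `<< indep_law P.
Proof. by move: hI; rewrite /I_chi2 /chi2; case: asboolP. Qed.

Lemma has_mean_phiM k l : lam k != 0 -> lam l != 0 ->
  has_mean (margX P) (fun x => phi k x * phi l x) (k == l)%:R.
Proof.
by move=> k0 l0; apply: has_mean_mul_L2;
  [exact: phi_L2 hdec _ k0|exact: phi_L2 hdec _ l0|exact: phi_orthonormal hdec _ _ k0 l0].
Qed.

Lemma has_mean_psiM k l : lam k != 0 -> lam l != 0 ->
  has_mean (margY P) (fun x => psi k x * psi l x) (k == l)%:R.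
Proof.
by move=> k0 l0; apply: has_mean_mul_L2;
  [exact: psi_L2 hdec _ k0|exact: psi_L2 hdec _ l0|exact: psi_orthonormal hdec _ _ k0 l0].
Qed.

Let lam0 : lam 0%N != 0. Proof. by rewrite (sv0 hdec) oner_neq0. Qed.

(** The mean is the scalar product with phi_0 = 1. *)
Lemma has_mean_phi k : lam k != 0 -> has_mean (margX P) (phi k) (k == 0%N)%:R.
Proof.
move=> k0; apply: eq_has_mean (has_mean_phiM k0 lam0) => // x.
by rewrite (phi0 hdec) mulr1.
Qed.

Lemma has_mean_psi k : lam k != 0 -> has_mean (margY P) (psi k) (k == 0%N)%:R.
Proof.
move=> k0; apply: eq_has_mean (has_mean_psiM k0 lam0) => // x.
by rewrite (psi0 hdec) mulr1.
Qed.

Lemma measurable_phi k : lam k != 0 -> measurable_fun setT (phi k).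
Proof. by move/has_mean_phi/has_mean_measurable. Qed.

Lemma measurable_psi k : lam k != 0 -> measurable_fun setT (psi k).
Proof. by move/has_mean_psi/has_mean_measurable. Qed.

(** This is the singular value relation <phi_k, L psi_l> = lambda_l <phi_k, phi_l>:
the mean under [P] is a mean under the product of the marginals weighted by the
likelihood ratio, and integrating out the second coordinate first makes the
Hilbert-Schmidt operator appear. *)
Lemma has_mean_phi_psi k l : lam k != 0 -> lam l != 0 ->
  has_mean P (fun z => phi k z.1 * psi l z.2) ((k == l)%:R * lam k).
Proof.
move=> k0 l0; pose f z := phi k z.1 * psi l z.2.
have mf : measurable_fun setT f.
  by apply: measurable_funM; apply: measurableT_comp => //;
    [exact: measurable_phi|exact: measurable_psi].
have [fi2 _] := has_meanD (has_mean_comp (has_mean_phiM k0 k0))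
                          (has_mean_comp (has_mean_psiM l0 l0)).
have fi : P.-integrable setT (EFin \o f).
  apply: le_integrable fi2 => //; first exact/measurable_EFinP.
  move=> z _; rewrite /= lee_fin /f.
  set a := phi k z.1; set b := psi l z.2.
  rewrite normrM -!expr2 [leRHS]ger0_norm ?addr_ge0 ?sqr_ge0//.
  (* |a b| <= a^2 + b^2, from (|a| - |b|)^2 >= 0 *)
  have := sqr_ge0 (`|a| - `|b|).
  rewrite sqrrB !real_normK ?num_real// => ab.
  have := sqr_ge0 a; have := sqr_ge0 b; lra.
have PQ := I_chi2_dominated.
apply: (has_mean_change_of_law PQ fi).
have fL : (fun z => (f z * lratio P z)%:E) = (fun z => (EFin \o f) z *
    Radon_Nikodym (charge_of_finite_measure P) (indep_law P) z)%E.
  by apply/funext => z; rewrite EFinM fineK// Radon_Nikodym_fin_num.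
have fLi := integrable_Radon_Nikodym PQ fi.
rewrite -fL in fLi.
split; first exact: fLi.
rewrite -[LHS](integral12_prod_meas1 fLi) /fubini_F /=.
have [/measurable_int mphi <-] : has_mean (margX P) (fun x => lam l * (phi k x * phi l x))
    ((k == l)%:R * lam k).
  apply: eq_has_mean (has_meanZ (lam l) (has_mean_phiM k0 l0)) => //.
  by rewrite mulrC; case: eqP => [->//|]; rewrite !mul0r.
apply: ae_eq_integral => //; first exact: measurable_fubini_F fLi.
have := ae_integrable1 fLi; have := hs_psi hdec l0.
apply: filterS2 => x hx xi _ /=.
(* Where [phi k] vanishes, the integrability of the section of the product tells
   nothing about [psi l] times the likelihood ratio. *)
have [xk|xk] := eqVneq (phi k x) 0.
  rewrite /f /= xk mul0r mulr0.
  by under eq_integral do rewrite !mul0r; rewrite integral0.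
have gi : (margY P).-integrable setT (fun y => (lratio P (x, y) * psi l y)%:E).
  have := @integrableZl _ _ _ (margY P) setT measurableT (phi k x)^-1 _ xi.
  apply: eq_integrable => // y _ /=; rewrite -EFinM /f /=; congr _%:E.
  by rewrite -mulrA mulKf// mulrC.
rewrite mulrCA -hx /hs_operator unlock EFinM fineK; last exact: integrable_fin_num.
rewrite -integralZl//; apply: eq_integral => y _; rewrite -EFinM /f /=.
by rewrite -mulrA [psi l y * _]mulrC.
Qed.

End spectral_moments.

(** * Mixed moments of two unmatched pairs *)

Section mixed_moments.
Context dX dY (X : measurableType dX) (Y : measurableType dY) (R : realType).
Variable P : probability (X * Y)%type R.
Variables (lam : nat -> R) (phi : nat -> X -> R) (psi : nat -> Y -> R).
Hypothesis hI : (I_chi2 P < +oo)%E.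
Hypothesis hdec : spectral_decomposition P lam phi psi.

Let mean_phi k (k0 : lam k != 0) := has_mean_phi hdec k0.
Let mean_psi k (k0 : lam k != 0) := has_mean_psi hdec k0.

(** Mean, at one coordinate of the planted sample, of the product of those factors
among phi_k(X), phi_l(X), psi_k(Y), psi_l(Y) that sit there; [b1], ..., [b4] tell
which ones do, [delta] is the Kronecker symbol of k and l, and [a] is lambda_k.
An unmatched pair has its two factors at different coordinates, so [b1] excludes
[b3] and [b2] excludes [b4], and at most two factors meet. *)
Definition coordinate_mean (b1 b2 b3 b4 : bool) (delta a : R) : R :=
  if (b1 && b2) || (b3 && b4) then delta
  else if (b1 && b4) || (b2 && b3) then delta * a
  else (~~ [|| b1, b2, b3 | b4])%:R.

Lemma has_mean_coordinate_mean k l (b1 b2 b3 b4 : bool) :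
  k != 0%N -> l != 0%N -> lam k != 0 -> lam l != 0 ->
  ~~ (b1 && b3) -> ~~ (b2 && b4) ->
  has_mean P (fun z =>
    ((if b1 then phi k z.1 else 1) * (if b2 then phi l z.1 else 1)) *
    ((if b3 then psi k z.2 else 1) * (if b4 then psi l z.2 else 1)))
  (coordinate_mean b1 b2 b3 b4 (k == l)%:R (lam k)).
Proof.
move=> k0 l0 lk ll.
have phi1 i : i != 0%N -> lam i != 0 -> has_mean P (fun z => phi i z.1) 0.
  move=> i0 li; apply: eq_has_mean (has_mean_comp (mean_phi li)) => //.
  by rewrite (negbTE i0).
have psi1 i : i != 0%N -> lam i != 0 -> has_mean P (fun z => psi i z.2) 0.
  move=> i0 li; apply: eq_has_mean (has_mean_comp (mean_psi li)) => //.
  by rewrite (negbTE i0).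
have swap : (k == l)%:R * lam k = (l == k)%:R * lam l.
  by have [->|_] := eqVneq k l; rewrite ?eqxx// !mul0r.
case: b1 b2 b3 b4 => [] [] [] [] // _ _; rewrite /coordinate_mean /=.
- by apply: eq_has_mean (has_mean_comp (has_mean_phiM hdec lk ll)) => // z /=; rewrite !mulr1.
- by apply: eq_has_mean (has_mean_phi_psi hI hdec lk ll) => // z /=; rewrite mulr1 mul1r.
- by apply: eq_has_mean (phi1 k k0 lk) => // z; rewrite !mulr1.
- by apply: eq_has_mean (has_mean_phi_psi hI hdec ll lk) => // z /=; rewrite mulr1 mul1r.
- by apply: eq_has_mean (phi1 l l0 ll) => // z; rewrite !mulr1 mul1r.
- by apply: eq_has_mean (has_mean_comp (has_mean_psiM hdec lk ll)) => // z /=; rewrite !mul1r.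
- by apply: eq_has_mean (psi1 k k0 lk) => // z; rewrite !mul1r mulr1.
- by apply: eq_has_mean (psi1 l l0 ll) => // z; rewrite !mul1r.
- by apply: eq_has_mean (has_mean_cst P 1) => // z; rewrite !mul1r.
Qed.

(** A coordinate holding exactly one factor annihilates the product. With phi_k,
phi_l at [i1], [i2] and psi_k, psi_l at [q1], [q2], every factor meets another one
only if [i1 = i2] and [q1 = q2], or [i1 = q2] and [i2 = q1]. *)
Lemma prod_coordinate_mean n (i1 i2 q1 q2 : 'I_n) (b : bool) (a : R) :
  i1 != q1 -> i2 != q2 ->
  \prod_i coordinate_mean (i == i1) (i == i2) (i == q1) (i == q2) b%:R a =
  b%:R * (((i1 == i2) && (q1 == q2))%:R + ((i1 == q2) && (i2 == q1))%:R * a ^+ 2).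
Proof.
move=> iq1 iq2.
have bb : b%:R * b%:R = b%:R :> R by case: b; rewrite ?mulr1 ?mulr0.
have prod2 (i j : 'I_n) c : i != j ->
  \prod_k (if (k == i) || (k == j) then c else 1) = c * c :> R.
  move=> ij; rewrite -{2}(prod_atE i (fun=> c)) -{3}(prod_atE j (fun=> c)) -big_split.
  apply: eq_bigr => k _; have [->|_] := eqVneq k i => /=.
    by rewrite (negbTE ij) mulr1.
  by rewrite mul1r.
have zero i : coordinate_mean (i == i1) (i == i2) (i == q1) (i == q2) b%:R a = 0 ->
    \prod_i coordinate_mean (i == i1) (i == i2) (i == q1) (i == q2) b%:R a = 0.
  by move=> e; apply/eqP/prodf_eq0; exists i => //; rewrite e.
have [ii|ii] := eqVneq i1 i2.
  rewrite -ii in iq2 zero *; rewrite (negbTE iq2) (negbTE iq1) mul0r addr0.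
  have [qq|qq] := eqVneq q1 q2.
    rewrite -qq mulr1 -[RHS]bb -[RHS](prod2 _ _ _ iq1); apply: eq_bigr => i _.
    rewrite /coordinate_mean !andbb.
    by have [//|] := ifPn; rewrite negb_or => /andP[/negbTE-> /negbTE->].
  rewrite /= mulr0; apply: (zero q1).
  by rewrite /coordinate_mean eqxx (eq_sym q1) (negbTE iq1) (negbTE qq).
rewrite add0r; have [iq|iq] := eqVneq i1 q2.
  have [qi|qi] := eqVneq i2 q1.
    rewrite mul1r -[in RHS]bb expr2 mulrACA -[RHS](prod2 _ _ _ ii); apply: eq_bigr => i _.
    rewrite -iq -qi /coordinate_mean !andbb.
    have [->|_] := eqVneq i i1; first by rewrite (negbTE ii).
    by case: eqP.
  rewrite mul0r mulr0; apply: (zero i2).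
  by rewrite /coordinate_mean eqxx (negbTE iq2) (negbTE qi) (eq_sym i2) (negbTE ii).
rewrite mul0r mulr0; apply: (zero i1).
by rewrite /coordinate_mean eqxx (negbTE ii) (negbTE iq1) (negbTE iq).
Qed.

Lemma has_mean_planted_mixed n m (p : {ffun 'I_m -> 'I_n}) k l
    (i1 i2 : 'I_n) (j1 j2 : 'I_m) : injective p ->
  k != 0%N -> l != 0%N -> lam k != 0 -> lam l != 0 -> i1 != p j1 -> i2 != p j2 ->
  has_mean (planted_law P p)
    (fun s => (phi k (tnth s.1 i1) * psi k (tnth s.2 j1)) *
              (phi l (tnth s.1 i2) * psi l (tnth s.2 j2)))
    ((k == l)%:R * (((i1 == i2) && (j1 == j2))%:R +
                    ((i1 == p j2) && (i2 == p j1))%:R * lam k ^+ 2)).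
Proof.
move=> pI k0 l0 lk ll ij1 ij2.
pose g i x := (if i == i1 then phi k x else 1) * (if i == i2 then phi l x else 1).
pose h j y := (if j == j1 then psi k y else 1) * (if j == j2 then psi l y else 1).
pose c i := coordinate_mean (i == i1) (i == i2) (i == p j1) (i == p j2) (k == l)%:R (lam k).
have mg i : measurable_fun setT (g i).
  by rewrite /g; case: (i == i1); case: (i == i2); apply: measurable_funM => //;
    exact: (measurable_phi hdec).
have mh j : measurable_fun setT (h j).
  by rewrite /h; case: (j == j1); case: (j == j2); apply: measurable_funM => //;
    exact: (measurable_psi hdec).
have hgh j : has_mean P (fun z => g (p j) z.1 * h j z.2) (c (p j)).
  rewrite /c !(inj_eq pI); apply: has_mean_coordinate_mean => //.
    by apply/negP => /andP[/eqP pj /eqP jj]; rewrite -pj jj eqxx in ij1.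
  by apply/negP => /andP[/eqP pj /eqP jj]; rewrite -pj jj eqxx in ij2.
have hg i : i \notin codom p -> has_mean (margX P) (g i) (c i).
  move=> ip; have ipj j : (i == p j) = false.
    by apply/negbTE/negP => /eqP ij; rewrite ij codom_f in ip.
  apply: has_mean_distribution => //.
  rewrite /c !ipj; apply: eq_has_mean (@has_mean_coordinate_mean k l (i == i1) (i == i2)
    false false k0 l0 lk ll _ _) => [z|||]; rewrite ?andbF//.
  by rewrite /= !mulr1.
apply: eq_has_mean (has_mean_planted pI mg mh hgh hg) => [s|].
  by rewrite !big_split/= !prod_atE mulrACA.
by rewrite prod_coordinate_mean// (inj_eq pI).
Qed.
End mixed_moments.

(** * Second moments of the sum over all pairs *)

Lemma has_mean_sqr_sum d (T : measurableType d) (R : realType) (P : probability T R)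
    (I : eqType) (s : seq I) (h : I -> T -> R) (c : I -> R) : uniq s ->
  (forall k l, k \in s -> l \in s ->
    has_mean P (fun x => h k x * h l x) ((k == l)%:R * c k)) ->
  has_mean P (fun x => (\sum_(k <- s) h k x) ^+ 2) (\sum_(k <- s) c k).
Proof.
move=> us hs.
apply: (@eq_has_mean _ _ _ _ (fun x => \sum_(k <- s) \sum_(l <- s) h k x * h l x) _
  (\sum_(k <- s) \sum_(l <- s) (k == l)%:R * c k)) => [x||].
- by rewrite expr2 mulr_suml; apply: eq_bigr => k _; rewrite mulr_sumr.
- apply: eq_big_seq => k ks; rewrite (bigD1_seq k)//= big1 => [|l /negbTE lk].
    by rewrite eqxx mul1r addr0.
  by rewrite eq_sym lk mul0r.
- by apply: has_mean_sum => k ks; apply: has_mean_sum => l ls; exact: hs.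
Qed.

Section truncation.
Context dX dY (X : measurableType dX) (Y : measurableType dY) (R : realType).
Variable P : probability (X * Y)%type R.
Variables (lam : nat -> R) (phi : nat -> X -> R) (psi : nat -> Y -> R).
Hypothesis hI : (I_chi2 P < +oo)%E.
Hypothesis hdec : spectral_decomposition P lam phi psi.
Variable r : nat.

Let f := trunc_lratio lam phi psi r.

(** Orthonormality is only granted to the modes with a nonzero singular value. *)
Definition active_modes : seq nat := [seq k <- index_iota 1 r.+1 | lam k != 0].

Let ks := active_modes.

Let uniq_ks : uniq ks. Proof. by rewrite filter_uniq// iota_uniq. Qed.

Let ksP k : k \in ks -> k != 0%N /\ lam k != 0.
Proof. by rewrite mem_filter mem_index_iota lt0n => /andP[-> /andP[-> _]]. Qed.

Lemma trunc_lratioE z : f z = \sum_(k <- ks) lam k * (phi k z.1 * psi k z.2).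
Proof.
rewrite big_filter big_mkcond; apply: eq_bigr => k _; rewrite -mulrA.
by case: eqP => // ->; rewrite mul0r.
Qed.

Lemma measurable_trunc_lratio : measurable_fun setT f.
Proof.
have -> : f = (fun z => \sum_(k <- ks) lam k * (phi k z.1 * psi k z.2)).
  by apply/funext => z; rewrite trunc_lratioE.
rewrite (_ : (fun _ => _) = (fun z => \sum_(k <- ks) (fun k z =>
  if lam k != 0 then lam k * (phi k z.1 * psi k z.2) else 0) k z)); last first.
  by apply/funext => z; apply: eq_bigr => k _; case: eqP => // ->; rewrite mul0r.
apply: measurable_sum => k; have [_|k0] /= := eqVneq (lam k) 0; first exact: measurable_cst.
apply: measurable_funM => //; apply: measurable_funM; apply: measurableT_comp => //.
  exact: (measurable_phi hdec).
exact: (measurable_psi hdec).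
Qed.

Let I := \sum_(k <- ks) lam k ^+ 2.

Lemma trunc_I_chi2E : trunc_I_chi2 P lam phi psi r = I.
Proof.
rewrite /trunc_I_chi2.
suff /has_mean_expectation -> : has_mean (indep_law P) (fun z => f z ^+ 2) I by [].
have : has_mean (indep_law P) (fun z =>
    (\sum_(k <- ks) lam k * (phi k z.1 * psi k z.2)) ^+ 2) I.
  apply: has_mean_sqr_sum => // k l /ksP[_ k0] /ksP[_ l0].
  have := has_meanZ (lam k * lam l)
    (has_mean_prod (has_mean_phiM hdec k0 l0) (has_mean_psiM hdec k0 l0)).
  apply: eq_has_mean => [z|]; first by ring.
  by have [->|_] := eqVneq k l; rewrite ?mul0r ?mulr0// !mulr1 mul1r.
by apply: eq_has_mean => // z; rewrite trunc_lratioE.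
Qed.

Lemma has_mean_trunc_lratio : has_mean P f I.
Proof.
have : has_mean P (fun z => \sum_(k <- ks) lam k * (phi k z.1 * psi k z.2)) I.
  apply: has_mean_sum => k /ksP[_ k0].
  have := has_meanZ (lam k) (has_mean_phi_psi hI hdec k0 k0).
  by apply: eq_has_mean => //; rewrite eqxx mul1r.
by apply: eq_has_mean => // z; rewrite -trunc_lratioE.
Qed.

Let lam_le1 k : lam k <= 1.
Proof. by rewrite -(sv0 hdec); exact: sv_noninc hdec _ _ _. Qed.

Section samples.
Variables n m : nat.

Definition pair_sum (s : n.-tuple X * m.-tuple Y) : R :=
  \sum_(i < n) \sum_(j < m) f (tnth s.1 i, tnth s.2 j).

Lemma pair_sumE s : pair_sum s =
  \sum_(k <- ks) lam k *
    ((\sum_(i < n) phi k (tnth s.1 i)) * (\sum_(j < m) psi k (tnth s.2 j))).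
Proof.
rewrite /pair_sum; under eq_bigr do under eq_bigr do rewrite trunc_lratioE.
under eq_bigr do rewrite exchange_big; rewrite exchange_big; apply: eq_bigr => k _.
rewrite mulr_suml mulr_sumr; apply: eq_bigr => i _ /=.
by rewrite -mulr_sumr -mulr_sumr.
Qed.

Lemma measurable_pair_term (i : 'I_n) (j : 'I_m) :
  measurable_fun setT (fun s : n.-tuple X * m.-tuple Y => f (tnth s.1 i, tnth s.2 j)).
Proof.
apply: (measurableT_comp measurable_trunc_lratio).
apply: measurable_fun_pair.
  exact: (measurableT_comp (measurable_tnth i) measurable_fst).
exact: (measurableT_comp (measurable_tnth j) measurable_snd).
Qed.

Lemma measurable_pair_sum : measurable_fun setT pair_sum.
Proof.
by do 2 (apply: measurable_sum => ?); exact: measurable_pair_term.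
Qed.

(** The sum over pairs is a combination of products of a sum over the X_i with a
sum over the Y_j, which are independent under the null hypothesis. *)
Lemma has_mean_null_sqr :
  has_mean (null_law n m P) (fun s => pair_sum s ^+ 2) ((n * m)%:R * I).
Proof.
rewrite /I mulr_sumr.
have : has_mean (null_law n m P) (fun s => (\sum_(k <- ks) lam k *
    ((\sum_(i < n) phi k (tnth s.1 i)) * (\sum_(j < m) psi k (tnth s.2 j)))) ^+ 2)
    (\sum_(k <- ks) (n * m)%:R * lam k ^+ 2).
  apply: has_mean_sqr_sum => // k l /ksP[k1 k0] /ksP[l1 l0].
  have phi00 i : i != 0%N -> lam i != 0 -> has_mean (margX P) (phi i) 0.
    by move=> i1 i0; apply: eq_has_mean (has_mean_phi hdec i0) => //; rewrite (negbTE i1).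
  have psi00 i : i != 0%N -> lam i != 0 -> has_mean (margY P) (psi i) 0.
    by move=> i1 i0; apply: eq_has_mean (has_mean_psi hdec i0) => //; rewrite (negbTE i1).
  have := has_meanZ (lam k * lam l) (has_mean_prod
    (has_mean_iid_sumM n (phi00 k k1 k0) (phi00 l l1 l0) (has_mean_phiM hdec k0 l0))
    (has_mean_iid_sumM m (psi00 k k1 k0) (psi00 l l1 l0) (has_mean_psiM hdec k0 l0))).
  apply: eq_has_mean => [z|]; first by ring.
  by have [->|_] := eqVneq k l; rewrite ?mulr0 ?mul0r// !mulr1 mul1r natrM; ring.
by apply: eq_has_mean => // z; rewrite pair_sumE.
Qed.

Section planted.
Variable p : {ffun 'I_m -> 'I_n}.
Hypothesis p_inj : injective p.

Definition matched_sum (s : n.-tuple X * m.-tuple Y) : R :=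
  \sum_(j < m) (f (tnth s.1 (p j), tnth s.2 j) - I).

Definition unmatched : seq ('I_n * 'I_m) :=
  [seq d <- enum predT | d.1 != p d.2].

Definition unmatched_sum (s : n.-tuple X * m.-tuple Y) : R :=
  \sum_(d <- unmatched) f (tnth s.1 d.1, tnth s.2 d.2).

Lemma pair_sum_split s :
  pair_sum s - m%:R * I = matched_sum s + unmatched_sum s.
Proof.
rewrite /pair_sum pair_bigA /= (bigID (fun d => d.1 == p d.2)) /=.
rewrite /matched_sum sumrB sumr_const card_ord mulr_natl addrAC; congr (_ - _ + _).
  rewrite -(pair_big_dep xpredT (fun i j => i == p j)
    (fun i j => f (tnth s.1 i, tnth s.2 j))) (exchange_big_dep xpredT)//=.
  by apply: eq_bigr => j _; rewrite big_pred1_eq.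
by rewrite /unmatched_sum big_filter big_enum_cond.
Qed.

Lemma has_mean_matched_sqr v : has_mean P (fun z => f z ^+ 2) v ->
  has_mean (planted_law P p) (fun s => matched_sum s ^+ 2) (m%:R * (v - I ^+ 2)).
Proof.
move=> fv; pose g z := f z - I.
have g0 : has_mean P g 0.
  have := has_meanD has_mean_trunc_lratio (has_mean_cst P (- I)).
  by apply: eq_has_mean => //; rewrite subrr.
have g2 : has_mean P (fun z => g z * g z) (v - I ^+ 2).
  have := has_meanD (has_meanD fv (has_meanZ (- 2 * I) has_mean_trunc_lratio))
    (has_mean_cst P (I ^+ 2)).
  by apply: eq_has_mean => [z|]; rewrite /g; ring.
apply: has_mean_planted_pairs (has_mean_iid_sumM m g0 g0 g2).
  apply: measurable_funX; apply: measurable_sum => j; apply: measurable_funB => //.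
  exact: measurable_pair_term.
move=> zx; rewrite expr2 /matched_sum.
suff -> : \sum_(j < m) (f (tnth (plant p zx).1 (p j), tnth (plant p zx).2 j) - I) =
  \sum_(i < m) g (tnth zx.1 i) by [].
apply: eq_bigr => j _; rewrite tnth_plant// tnth_mktuple /g.
by case: (tnth zx.1 j).
Qed.

(** The mean of the squared sum of phi_k(X_i) psi_k(Y_j) over the unmatched pairs:
equal pairs have correlation 1, swapped pairs have correlation [lam k ^+ 2]. *)
Definition unmatched_overlap (k : nat) : R :=
  \sum_(d <- unmatched) \sum_(d' <- unmatched)
   (((d.1 == d'.1) && (d.2 == d'.2))%:R +
    ((d.1 == p d'.2) && (d'.1 == p d.2))%:R * lam k ^+ 2).

(** Each pair is equal to one pair and, [p] being injective, swapped with at most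
one; moreover [lam k <= lam 0 = 1]. *)
Lemma unmatched_overlap_le k : unmatched_overlap k <= 2 * (n * m)%:R.
Proof.
have one (b : pred ('I_n * 'I_m)) : (forall d d', b d -> b d' -> d = d') ->
    \sum_(d' <- unmatched) (b d')%:R <= 1 :> R.
  move=> bI; rewrite -natr_sum lern1
    (_ : (\sum_(d' <- unmatched) b d' = count b unmatched)%N); last first.
    by rewrite -sum1_count [RHS]big_mkcond.
  rewrite -size_filter.
  have : uniq [seq d <- unmatched | b d] by do 2 apply: filter_uniq; exact: enum_uniq.
  have : forall d, d \in [seq d <- unmatched | b d] -> b d.
    by move=> d; rewrite mem_filter => /andP[].
  case: [seq d <- unmatched | b d] => [|d [|d' s]]//= hb.
  by rewrite inE negb_or (bI d d') ?eqxx// hb ?inE ?eqxx ?orbT.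
apply: (@le_trans _ _ (\sum_(d <- unmatched) 2%:R)).
  apply: ler_sum => d _; rewrite big_split /= (_ : 2%:R = 1 + 1)//; apply: lerD.
    apply: (one (fun d' => (d.1 == d'.1) && (d.2 == d'.2)))
      => a b /andP[/eqP a1 /eqP a2] /andP[/eqP b1 /eqP b2].
    by apply: injective_projections; rewrite -?a1 -?a2.
  rewrite -mulr_suml -[leRHS]mulr1; apply: ler_pM; [exact: sumr_ge0|exact: sqr_ge0| |].
    apply: (one (fun d' => (d.1 == p d'.2) && (d'.1 == p d.2)))
      => a b /andP[/eqP a1 /eqP a2] /andP[/eqP b1 /eqP b2].
    by apply: injective_projections; [rewrite a2 b2|apply: p_inj; rewrite -a1 -b1].
  by rewrite expr_le1 ?(sv_ge0 hdec).
rewrite big_const_seq count_predT iter_addr_0 -[leLHS]mulr_natr.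
rewrite ler_pM2l// ler_nat.
apply: leq_trans (_ : (size (enum {: 'I_n * 'I_m}) <= _)%N).
  by rewrite size_filter count_size.
by rewrite -cardE card_prod !card_ord.
Qed.

Lemma has_mean_unmatched_sqr :
  has_mean (planted_law P p) (fun s => unmatched_sum s ^+ 2)
    (\sum_(k <- ks) lam k ^+ 2 * unmatched_overlap k).
Proof.
pose h k (s : n.-tuple X * m.-tuple Y) :=
  \sum_(d <- unmatched) lam k * (phi k (tnth s.1 d.1) * psi k (tnth s.2 d.2)).
have : has_mean (planted_law P p) (fun s => (\sum_(k <- ks) h k s) ^+ 2)
    (\sum_(k <- ks) lam k ^+ 2 * unmatched_overlap k).
  apply: has_mean_sqr_sum => // k l /ksP[k1 k0] /ksP[l1 l0].
  have : has_mean (planted_law P p) (fun s => \sum_(d <- unmatched)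
      \sum_(d' <- unmatched) lam k * lam l *
      ((phi k (tnth s.1 d.1) * psi k (tnth s.2 d.2)) *
       (phi l (tnth s.1 d'.1) * psi l (tnth s.2 d'.2))))
    (\sum_(d <- unmatched) \sum_(d' <- unmatched) lam k * lam l *
      ((k == l)%:R * (((d.1 == d'.1) && (d.2 == d'.2))%:R +
        ((d.1 == p d'.2) && (d'.1 == p d.2))%:R * lam k ^+ 2))).
    apply: has_mean_sum => d; rewrite mem_filter => /andP[dp _].
    apply: has_mean_sum => d'; rewrite mem_filter => /andP[dp' _].
    apply: has_meanZ; exact: (has_mean_planted_mixed hI hdec).
  apply: eq_has_mean => [s|].
    rewrite mulr_suml; apply: eq_bigr => d _; rewrite mulr_sumr.
    by apply: eq_bigr => d' _; ring.
  have [->|_] := eqVneq k l; last first.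
    by rewrite mul0r big1// => d _; rewrite big1// => d' _; rewrite mul0r mulr0.
  rewrite mul1r mulr_sumr; apply: eq_bigr => d _; rewrite mulr_sumr.
  by apply: eq_bigr => d' _; rewrite mul1r.
apply: eq_has_mean => // s; congr (_ ^+ 2).
by rewrite exchange_big; apply: eq_bigr => d _; rewrite trunc_lratioE.
Qed.

End planted.
End samples.
End truncation.

(** * Error probabilities *)

Section error_bounds.
Context dX dY (X : measurableType dX) (Y : measurableType dY) (R : realType).
Variable P : probability (X * Y)%type R.
Variables (lam : nat -> R) (phi : nat -> X -> R) (psi : nat -> Y -> R).
Hypothesis hI : (I_chi2 P < +oo)%E.
Hypothesis hdec : spectral_decomposition P lam phi psi.
Variables r n m : nat.

Let f := trunc_lratio lam phi psi r.
Let I := trunc_I_chi2 P lam phi psi r.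
Let S := @pair_sum _ _ X Y R lam phi psi r n m.

(** Half of the mean of the statistic under the alternative. *)
Definition threshold : R := (Num.sqrt (n * m)%:R)^-1 * (m%:R * I / 2).

Definition rejection : set (n.-tuple X * m.-tuple Y) :=
  [set s | threshold < T_inner f s].

Lemma measurable_rejection : measurable rejection.
Proof.
rewrite (_ : rejection = [set: _] `&` T_inner f @^-1` [set` `]threshold, +oo[]).
  have mT : measurable_fun setT (@T_inner _ _ X Y R n m f).
    apply: measurable_funM => //; exact: (measurable_pair_sum hdec).
  exact: mT.
by rewrite setTI; apply/seteqP; split => s; rewrite /= in_itv /= andbT.
Qed.

Hypotheses (n0 : (0 < n)%N) (m0 : (0 < m)%N) (I0 : 0 < I).

Let sqrt0 : 0 < (Num.sqrt (n * m)%:R)^-1 :> R.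
Proof. by rewrite invr_gt0 sqrtr_gt0 ltr0n muln_gt0 n0. Qed.

Let nR0 : 0 < n%:R :> R. Proof. by rewrite ltr0n. Qed.
Let mR0 : 0 < m%:R :> R. Proof. by rewrite ltr0n. Qed.

Lemma rejectionE : rejection = [set s | m%:R * I / 2 < S s].
Proof. by apply/seteqP; split => s; rewrite /rejection /= ltr_pM2l. Qed.

Lemma null_rejection_le :
  (null_law n m P rejection <= (4 * (n%:R / (m%:R * I)))%:E)%E.
Proof.
have hS := has_mean_null_sqr hdec r n m.
have mS2 := has_mean_measurable hS.
have mI0 : 0 < m%:R * I by exact: mulr_gt0.
have t0 : 0 < (m%:R * I / 2) ^+ 2 by rewrite exprn_gt0// divr_gt0.
have := markov_mean (fun s => sqr_ge0 _) hS t0.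
rewrite -(trunc_I_chi2E hdec) -/I => bound.
rewrite [X in (_ <= X%:E)%E](_ : _ = (n * m)%:R * I / (m%:R * I / 2) ^+ 2); last first.
  by rewrite natrM; field; rewrite !gt_eqF.
apply: le_trans bound; apply: le_measure; rewrite ?inE.
- exact: measurable_rejection.
- rewrite (_ : [set _ | _] = [set: _] `&` (fun s => S s ^+ 2) @^-1`
    [set` `[(m%:R * I / 2) ^+ 2, +oo[]); first exact: mS2.
  by rewrite setTI; apply/seteqP; split => s; rewrite /= in_itv /= andbT.
- rewrite rejectionE => s /= Ss; rewrite lerXn2r// ?nnegrE ?divr_ge0 ?(ltW mI0)//.
    by apply: le_trans (ltW Ss); rewrite divr_ge0// ltW.
  exact: ltW.
Qed.

(** Acceptance forces the sum a + b of the matched and unmatched fluctuations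
below - m I / 2, hence 2 a^2 + 2 b^2 above (m I / 2)^2, and Markov's inequality
applies to the latter. *)
Lemma planted_acceptance_le (p : {ffun 'I_m -> 'I_n}) (v : R) : injective p ->
  (m <= n)%N -> has_mean P (fun z => f z ^+ 2) v ->
  (planted_law P p (~` rejection) <=
   (8 * (v / (m%:R * I ^+ 2)) + 16 * (n%:R / (m%:R * I)))%:E)%E.
Proof.
move=> pI mn hv.
have hA := has_mean_matched_sqr hI hdec pI hv.
have hB := has_mean_unmatched_sqr hI hdec r pI.
have hW := has_meanD (has_meanZ 2 hA) (has_meanZ 2 hB).
have mW := has_mean_measurable hW.
move: hA hB hW mW; rewrite /= -(trunc_I_chi2E hdec) -/I => hA hB hW mW.
have mI0 : 0 < m%:R * I by exact: mulr_gt0.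
have t0 : 0 < (m%:R * I / 2) ^+ 2 by rewrite exprn_gt0// divr_gt0.
pose W (s : n.-tuple X * m.-tuple Y) := 2 * matched_sum lam phi psi r p s ^+ 2 +
            2 * unmatched_sum lam phi psi r p s ^+ 2.
have W0 s : 0 <= W s.
  by rewrite addr_ge0// mulr_ge0// sqr_ge0.
have bound := markov_mean W0 hW t0.
have BI : \sum_(k <- active_modes lam r) lam k ^+ 2 * unmatched_overlap lam p k <=
    2 * (n * m)%:R * I.
  rewrite /I (trunc_I_chi2E hdec) mulrC mulr_suml; apply: ler_sum => k _.
  by rewrite ler_wpM2l ?sqr_ge0// (unmatched_overlap_le hdec).
apply: (@le_trans _ _ (planted_law P p [set s | (m%:R * I / 2) ^+ 2 <= W s])); last first.
  apply: (le_trans bound).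
  rewrite lee_fin.
  have -> : 8 * (v / (m%:R * I ^+ 2)) + 16 * (n%:R / (m%:R * I)) =
      (2 * (m%:R * v) + 2 * (2 * (n * m)%:R * I)) / (m%:R * I / 2) ^+ 2.
    by rewrite natrM; field; rewrite !gt_eqF.
  rewrite ler_pM2r ?invr_gt0//.
  apply: lerD; rewrite ler_pM2l//.
  by rewrite ler_pM2l// lerBlDr lerDl sqr_ge0.
apply: (le_measure (planted_law P p)); rewrite ?inE.
- by apply: measurableC; exact: measurable_rejection.
- rewrite (_ : [set _ | _] = [set: _] `&` W @^-1`
    [set` `[(m%:R * I / 2) ^+ 2, +oo[]); first exact: mW.
  by rewrite setTI; apply/seteqP; split => s; rewrite /= in_itv /= andbT.
- rewrite rejectionE => s /= /negP; rewrite -leNgt => Ss.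
  have := pair_sum_split lam phi psi r p s.
  rewrite -(trunc_I_chi2E hdec) -/I -/S.
  set a := matched_sum _ _ _ _ _ _; set b := unmatched_sum _ _ _ _ _ _ => ab.
  have ab2 : m%:R * I / 2 <= - (a + b) by rewrite -ab; lra.
  have : (m%:R * I / 2) ^+ 2 <= (a + b) ^+ 2.
    rewrite -(sqrrN (a + b)) lerXn2r// nnegrE ?divr_ge0 ?(ltW mI0)//.
    by apply: le_trans ab2; rewrite divr_ge0// ltW.
  move=> h; rewrite /W -/a -/b; apply: le_trans h _.
  have := sqr_ge0 (a - b); rewrite sqrrB sqrrD; lra.
Qed.

Lemma alt_acceptance_le (mn : (m <= n)%N) (v : R) :
  has_mean P (fun z => f z ^+ 2) v ->
  (alt_law mn P (~` rejection) <=
   (8 * (v / (m%:R * I ^+ 2)) + 16 * (n%:R / (m%:R * I)))%:E)%E.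
Proof.
move=> hv; rewrite /= /alt_law.
set b := (X in (_ <= X)%E).
have card0 : 0 < #|injections n m|%:R :> R by rewrite ltr0n card_injections_gt0.
rewrite lee_pdivrMl// (@le_trans _ _ (\sum_(p in injections n m) b)%E)//.
  apply: lee_sum => p; rewrite inE => /injectiveP pI.
  exact: planted_acceptance_le.
by rewrite /b sumEFin sumr_const -EFinM [X in (_ <= X%:E)%E]mulr_natl.
Qed.

End error_bounds.

Lemma cvge_to0 (R : realType) (u : nat -> \bar R) : (forall n, (0 <= u n)%E) ->
  (forall eps : R, 0 < eps -> \forall n \near \oo, (u n <= eps%:E)%E) ->
  (u n @[n --> \oo] --> 0)%E.
Proof.
move=> u0 ule.
have fu : \forall n \near \oo, u n \is a fin_num.
  near=> n; rewrite ge0_fin_numE//.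
  apply: (@le_lt_trans _ _ 1%:E); last exact: ltry.
  by near: n; exact: ule.
apply/fine_cvgP; split => //; apply/cvgrPdist_le => eps eps0.
near=> n; rewrite sub0r normrN ger0_norm ?fine_ge0//.
rewrite -lee_fin fineK; last by near: n.
by near: n; exact: ule.
Unshelve. all: by end_near.
Qed.

Theorem theorem4 (R : realType) (dX dY : nat -> measure_display)
    (X : forall n, measurableType (dX n)) (Y : forall n, measurableType (dY n))
    (P : forall n, probability (X n * Y n)%type R)
    (m : nat -> nat) (hm : forall n, (m n <= n)%N)
    (hI : forall n, (I_chi2 (P n) < +oo)%E)
    (lam : nat -> nat -> R)
    (phi : forall n, nat -> X n -> R) (psi : forall n, nat -> Y n -> R)
    (hdec : forall n, spectral_decomposition (P n) (lam n) (@phi n) (@psi n))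
    (r : nat -> nat) (hr : forall n, (0 < r n)%N)
    (hvar : forall eps : R, 0 < eps -> \forall n \near \oo,
      ('E_(P n)[fun z =>
          (trunc_lratio (lam n) (@phi n) (@psi n) (r n) z ^+ 2)%R] <=
       (eps * ((m n)%:R *
         trunc_I_chi2 (P n) (lam n) (@phi n) (@psi n) (r n) ^+ 2))%:E)%E)
    (hlim : ((m n)%:R / n%:R *
        trunc_I_chi2 (P n) (lam n) (@phi n) (@psi n) (r n))
      @[n --> \oo] --> +oo) :
  exists tau : nat -> R,
    strong_detection (fun n => null_law n (m n) (P n))
      (fun n => alt_law (hm n) (P n))
      (fun n => [set s | tau n <
        T_inner (trunc_lratio (lam n) (@phi n) (@psi n) (r n)) s]).
Proof.
exists (fun n => threshold (P n) (lam n) (@phi n) (@psi n) (r n) n (m n)).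
pose I n := trunc_I_chi2 (P n) (lam n) (@phi n) (@psi n) (r n).
have large (eps : R) : 0 < eps -> \forall n \near \oo,
    [/\ (0 < n)%N, (0 < m n)%N, 0 < I n & n%:R / ((m n)%:R * I n) <= eps].
  move=> eps0; move/cvgryPge: hlim => /(_ eps^-1); apply: filterS => n.
  rewrite -/(I n) => h.
  have rho0 : 0 < (m n)%:R / n%:R * I n by apply: lt_le_trans h; rewrite invr_gt0.
  have In0 : 0 <= I n by rewrite /I (trunc_I_chi2E (hdec n)) sumr_ge0// => k _; exact: sqr_ge0.
  have nn : (0 < n)%N.
    by rewrite lt0n; apply: contraTneq rho0 => ->; rewrite invr0 mulr0 mul0r ltxx.
  have mm : (0 < m n)%N.
    by rewrite lt0n; apply: contraTneq rho0 => ->; rewrite !mul0r ltxx.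
  have II : 0 < I n.
    by rewrite lt0r In0 andbT; apply: contraTneq rho0 => ->; rewrite mulr0 ltxx.
  split=> //.
  have -> : n%:R / ((m n)%:R * I n) = ((m n)%:R / n%:R * I n)^-1.
    by rewrite !invfM invrK mulrCA mulrA.
  by rewrite -[leRHS]invrK lef_pV2// posrE ?invr_gt0.
split.
- by move=> n; exact: measurable_rejection (hdec n) _ _ _.
- apply: cvge_to0 => [n|eps eps0]; first exact: measure_ge0.
  have e0 : 0 < eps / 4 by rewrite divr_gt0.
  apply: filterS (large _ e0) => n [n0 m0 I0 h].
  apply: le_trans (null_rejection_le (hdec n) n0 m0 I0) _.
  by rewrite lee_fin; move: h; rewrite -/(I n); lra.
- apply: cvge_to0 => [n|eps eps0]; first exact: measure_ge0.
  (* the error is at most 8 v / (m I^2) + 16 n / (m I); each term gets eps / 2 *)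
  have e32 : 0 < eps / 32 by rewrite divr_gt0.
  have e16 : 0 < eps / 16 by rewrite divr_gt0.
  apply: filterS2 (large _ e32) (hvar _ e16) => n [n0 m0 I0 h].
  set f := trunc_lratio _ _ _ _; rewrite -/(I n) => vle.
  have mf : measurable_fun setT f := measurable_trunc_lratio (hdec n) (r n).
  pose v := fine 'E_(P n)[fun z => (f z ^+ 2)%R]%E.
  have E0 : (0 <= 'E_(P n)[fun z => (f z ^+ 2)%R])%E.
    by apply: expectation_ge0 => z; exact: sqr_ge0.
  have Efin : ('E_(P n)[fun z => (f z ^+ 2)%R] \is a fin_num)%E.
    by rewrite ge0_fin_numE//; apply: le_lt_trans vle (ltry _).
  have hv : has_mean (P n) (fun z => f z ^+ 2) v.
    have mf2 : measurable_fun setT (EFin \o (fun z => f z ^+ 2)).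
      by apply/measurable_EFinP; exact: measurable_funX.
    split; last by rewrite fineK// unlock.
    apply/integrableP; split => //; move: Efin; rewrite ge0_fin_numE// unlock.
    by under eq_integral => z _ do rewrite -[EFin _]gee0_abs ?lee_fin ?sqr_ge0//.
  apply: le_trans (alt_acceptance_le (hI n) (hdec n) n0 m0 I0 (hm n) hv) _.
  have vle' : v <= eps / 16 * ((m n)%:R * I n ^+ 2) by rewrite -lee_fin fineK.
  rewrite lee_fin -/(I n).
  have mI0 : 0 < (m n)%:R * I n ^+ 2 by rewrite mulr_gt0 ?ltr0n ?exprn_gt0.
  have : v / ((m n)%:R * I n ^+ 2) <= eps / 16 by rewrite ler_pdivrMr.
  by move: h; lra.
Qed.
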